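(* Let $N\ge2$, $0<\alpha<1$, and let $f\in L^\infty([0,\infty),L^1_2(\mathbb{R}^N))$ be a nonnegative smooth solution of $$\partial_t f-\Delta_v f=Q(f,f),\qquad v\in\mathbb{R}^N,\ t>0,$$ with initial data $f_0$ satisfying $f_0(v)\ge c_0\exp(-a_0|v|^{3/2})$ for all $v$, for some constants $c_0>0$, $a_0>0$. Then there are positive constants $K$, $b$ and $a$, generally depending on the solution, such that $$f(v,t)\ge K e^{-bt-a|v|^{3/2}}\quad\text{for all }t>0\text{ and all }v\in\mathbb{R}^N.$$ Further, if there are a constant $c_1>0$ and a ball $B(v_0,r_0)$ (with $v_0\in\mathbb{R}^N$, $r_0>0$) such that $f(v,t)\ge c_1$ for all $v\in B(v_0,r_0)$ and all $t$, then the lower bound $$f(v,t)\ge K e^{-a|v|^{3/2}}$$ holds uniformly in time (for all $t>0$ and all $v\in\mathbb{R}^N$), where now $K>0$ and $a>0$ will depend on $c_1$, $v_0$ and $r_0$.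
   Context: $L^1_2(\mathbb{R}^N)=\{f:\ f(1+|v|^2)\in L^1(\mathbb{R}^N)\}$. Inelastic hard sphere collision operator: fix the restitution coefficient $0<\alpha<1$ and $\beta=\frac{1+\alpha}{2}$. For $v,v_*\in\mathbb{R}^N$ and $\sigma\in S^{N-1}$ put $u=v-v_*$, $\nu=u/|u|$, $u'=(1-\beta)u+\beta|u|\sigma$, $v'=\frac{v+v_*}{2}+\frac{u'}{2}$, $v'_*=\frac{v+v_*}{2}-\frac{u'}{2}$. The kernel is $b(u,\sigma)=c_N\left(\frac{1-\nu\cdot\sigma}{2}\right)^{-\frac{N-3}{2}}$ with $c_N>0$ chosen so that $\int_{S^{N-1}}b(u,\sigma)\,d\sigma=1$ (this function $b(u,\sigma)$ is unrelated to the constant $b$ in the claim). With $f_*=f(v_* )$, $\psi'=\psi(v')$, etc., $Q(f,f)$ is defined by $$\int_{\mathbb{R}^N}Q(f,f)\psi\,dv=\frac12\int\int\int_{S^{N-1}}f f_*(\psi'+\psi'_*-\psi-\psi_* )|u|\,b(u,\sigma)\,d\sigma\,dv\,dv_*.$$ Equivalently $Q=Q^+-Q^-$ with $Q^-(f,f)=f\,(f*|v|)$ and $Q^+(f,f)(v)=\int\int f('v)f('v_* )\frac{1}{\alpha^2}|u|b(u,\sigma)\,d\sigma\,dv_*$, where $'v=\frac{v+v_*}{2}+\frac{'u}{2}$, $'v_*=\frac{v+v_*}{2}-\frac{'u}{2}$, $'u=(1-\gamma)u+\gamma|u|\sigma$, $\gamma=\frac{1+\alpha}{2\alpha}$. 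*)

(* Defs.v *)
From HB Require Import structures.
From mathcomp Require Import all_boot all_order all_algebra.
From mathcomp Require Import all_classical all_reals all_analysis.
From mathcomp Require Import measurable_realfun.

Set Implicit Arguments.
Unset Strict Implicit.
Unset Printing Implicit Defensive.
Import Order.TTheory GRing.Theory Num.Theory.
Import numFieldNormedType.Exports.
Local Open Scope classical_set_scope.
Local Open Scope ring_scope.

(* The norm of the normed module 'rV[R]_N is the sup norm, hence the separate
   Euclidean structure. *)
Definition dot (R : realType) (N : nat) (x y : 'rV[R]_N) : R :=
  \sum_(i < N) x ord0 i * y ord0 i.

Definition enorm (R : realType) (N : nat) (x : 'rV[R]_N) : R :=
  Num.sqrt (dot x x).

Definition sphere (R : realType) (N : nat) : set 'rV[R]_N :=
  [set x | enorm x = 1].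

(* Borel sigma-algebra of R^n, generated by the coordinates (compare the
   instance on n.-tuple T in the library). *)
Section measurable_rV.
Context {R : realType} (n : nat).

Let coors : 'I_n -> 'rV[R]_n -> R := fun i x => x ord0 i.

Let rV_set0 : g_sigma_preimage coors set0.
Proof. exact: sigma_algebra0. Qed.

Let rV_setC A : g_sigma_preimage coors A -> g_sigma_preimage coors (~` A).
Proof. exact: sigma_algebraC. Qed.

Let rV_bigcup (F : (set 'rV[R]_n)^nat) :
  (forall i, g_sigma_preimage coors (F i)) ->
  g_sigma_preimage coors (\bigcup_i (F i)).
Proof. exact: sigma_algebra_bigcup. Qed.

HB.instance Definition _ := @isMeasurable.Build default_measure_display
  'rV[R]_n (g_sigma_preimage coors) rV_set0 rV_setC rV_bigcup.

End measurable_rV.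

Lemma measurable_coord (R : realType) (n : nat) (i : 'I_n) :
  measurable_fun [set: 'rV[R]_n] (fun x => x ord0 i).
Proof.
move=> _ Y mY; rewrite setTI; apply: sub_sigma_algebra => /=.
rewrite -bigcup_seq/=; exists i => /=; first by rewrite mem_index_enum.
by exists Y => //; rewrite setTI.
Qed.

Lemma measurable_fun_rVP (R : realType) (n : nat) d (T : measurableType d)
    (f : T -> 'rV[R]_n) :
  (forall i, measurable_fun [set: T] (fun t => f t ord0 i)) ->
  measurable_fun [set: T] f.
Proof.
move=> mf _ A mA.
have /= : g_sigma_preimage
    (fun (i : 'I_n) (t : T) => f t ord0 i) `<=` measurable.
  apply: smallest_sub; first exact: sigma_algebra_measurable.
  case: n => [|n] in f mf A mA *; first by rewrite big_ord0.
  rewrite -bigcup_mkord_ord; apply: bigcup_sub => i Ii.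
  by move=> B [C mC <-]; exact: mf.
have -> : (fun (i : 'I_n) (t : T) => f t ord0 i) =
    (fun i => (fun x : 'rV[R]_n => x ord0 i) \o f) by [].
rewrite g_sigma_preimage_comp; apply.
by exists A.
Qed.

Definition rV_cons (R : realType) (n : nat) (p : R * 'rV[R]_n) : 'rV[R]_n.+1 :=
  row_mx p.1%:M p.2.

Lemma rV_cons0 (R : realType) (n : nat) (p : R * 'rV[R]_n) :
  rV_cons p ord0 ord0 = p.1.
Proof.
have := row_mxEl (p.1%:M : 'M[R]_1) p.2 ord0 ord0; rewrite [RHS]mxE eqxx mulr1n => <-.
by congr (row_mx _ _ _ _); exact/val_inj.
Qed.

Lemma rV_consS (R : realType) (n : nat) (p : R * 'rV[R]_n) (j : 'I_n) :
  rV_cons p ord0 (lift ord0 j) = p.2 ord0 j.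
Proof.
rewrite -(row_mxEr (p.1%:M : 'M[R]_1) p.2 ord0 j).
by congr (row_mx _ _ _ _); exact/val_inj.
Qed.

Lemma measurable_rV_cons (R : realType) (n : nat) :
  measurable_fun [set: R * 'rV[R]_n] (@rV_cons R n).
Proof.
apply: measurable_fun_rVP => i.
have [j ->|->] := unliftP ord0 i.
  under eq_fun do rewrite rV_consS.
  exact: (measurableT_comp (measurable_coord j) measurable_snd).
by under eq_fun do rewrite rV_cons0; exact: measurable_fst.
Qed.

(* Lebesgue measure on R^n, as an iterated product measure *)
Section lebesgue_rV.
Context {R : realType}.
Local Open Scope ereal_scope.

Section step.
Context (n : nat) (m : {sigma_finite_measure set 'rV[R]_n -> \bar R}).

Definition lebesgue_step : set 'rV[R]_n.+1 -> \bar R :=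
  pushforward (@lebesgue_measure R \x m) (@rV_cons R n).

Let lebesgue_step0 : lebesgue_step set0 = 0.
Proof. by rewrite /lebesgue_step /pushforward preimage_set0 measure0. Qed.

Let lebesgue_step_ge0 A : 0 <= lebesgue_step A.
Proof. by rewrite /lebesgue_step /pushforward; exact: measure_ge0. Qed.

Let lebesgue_step_sigma_additive : semi_sigma_additive lebesgue_step.
Proof.
move=> F mF tF mUF; rewrite /lebesgue_step /pushforward preimage_bigcup.
apply: measure_semi_sigma_additive.
- by move=> i; rewrite -[X in measurable X]setTI; exact: measurable_rV_cons.
- apply/trivIsetP => /= i j _ _ ij; rewrite -preimage_setI.
  by move/trivIsetP : tF => /(_ _ _ _ _ ij) ->//; rewrite preimage_set0.
- rewrite -preimage_bigcup -[X in measurable X]setTI.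
  exact: measurable_rV_cons.
Qed.

HB.instance Definition _ := isMeasure.Build _ _ _ lebesgue_step
  lebesgue_step0 lebesgue_step_ge0 lebesgue_step_sigma_additive.

Let lebesgue_step_sigma_finite : sigma_finite setT lebesgue_step.
Proof.
have /sigma_finiteP[F [FT Fnd Foo]] := sigma_finiteT (@lebesgue_measure R).
have /sigma_finiteP[G [GT Gnd Goo]] := sigma_finiteT m.
pose tl (x : 'rV[R]_n.+1) : 'rV[R]_n := (\row_i x ord0 (lift ord0 i))%R.
have mtl : measurable_fun setT tl.
  apply: measurable_fun_rVP => i; under eq_fun do rewrite mxE.
  exact: measurable_coord.
have tlcons p : tl (rV_cons p) = p.2.
  by apply/rowP => i; rewrite mxE rV_consS.
pose H k := [set x : 'rV[R]_n.+1 | F k (x ord0 ord0)] `&` [set x | G k (tl x)].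
exists H.
  apply/seteqP; split => // x _.
  have : [set: R] (x ord0 ord0) by [].
  rewrite FT => -[i _ Fi].
  have : [set: 'rV[R]_n] (tl x) by [].
  rewrite GT => -[j _ Gj].
  exists (maxn i j) => //; split => /=.
    by have /subsetPset := Fnd _ _ (leq_maxl i j); exact.
  by have /subsetPset := Gnd _ _ (leq_maxr i j); exact.
move=> k; split.
  apply: measurableI.
    rewrite -[X in measurable X]setTI.
    exact: (measurable_coord (@ord0 n)) (Foo k).1.
  by rewrite -[X in measurable X]setTI; exact: mtl (Goo k).1.
rewrite /lebesgue_step /pushforward.
have -> : @rV_cons R n @^-1` H k = F k `*` G k.
  by apply/seteqP; split => -[a b] /=; rewrite /H/= rV_cons0 tlcons.
rewrite product_measure1E//; [|exact: (Foo k).1|exact: (Goo k).1].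
by rewrite lte_mul_pinfty// ?ge0_fin_numE// ?(Foo k).2 ?(Goo k).2.
Qed.

HB.instance Definition _ := @Measure_isSigmaFinite.Build _ _ _
  lebesgue_step lebesgue_step_sigma_finite.

End step.

Fixpoint lebesgue_rV (n : nat) : {sigma_finite_measure set 'rV[R]_n -> \bar R} :=
  match n with
  | 0 => [the {sigma_finite_measure set 'rV[R]_0 -> \bar R} of
            @dirac _ 'rV[R]_0 0%R R]
  | n'.+1 => [the {sigma_finite_measure set 'rV[R]_n'.+1 -> \bar R} of
            lebesgue_step (lebesgue_rV n')]
  end.

End lebesgue_rV.

Lemma lebesgue_rV_cube (R : realType) (n : nat) (r : R) : 0 <= r ->
  lebesgue_rV n [set x : 'rV[R]_n | forall i, `[0, r]%classic (x ord0 i)] =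
  (r ^+ n)%:E.
Proof.
move=> r0; elim: n => [|n IH].
  by rewrite /= diracE expr0 mem_set//=; case.
rewrite /= /lebesgue_step /pushforward.
transitivity ((@lebesgue_measure R \x lebesgue_rV n)%E (`[0,r]%classic `*`
    [set x : 'rV[R]_n | forall i, `[0, r]%classic (x ord0 i)])).
  congr (_ _); apply/seteqP; split => -[a b].
    move=> h; split; first by move: (h ord0); rewrite (rV_cons0 (a,b)).
    by move=> i; move: (h (lift ord0 i)); rewrite (rV_consS (a,b)).
  move=> [h1 h2] i; have [j ->|->] := unliftP ord0 i.
    by rewrite (rV_consS (a,b)); exact: h2.
  by rewrite (rV_cons0 (a,b)); exact: h1.
rewrite product_measure1E//=; last first.
  rewrite [X in measurable X](_ : _ = \bigcap_(i in [set: 'I_n])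
    ((fun x : 'rV[R]_n => x ord0 i) @^-1` `[0,r]%classic)); last first.
    by apply/seteqP; split => x h i; [move=> _; exact: h|exact: h].
  apply: fin_bigcap_measurable; first exact: finite_finset.
  by move=> i _; rewrite -[X in measurable X]setTI; exact: measurable_coord.
transitivity (r%:E * (r ^+ n)%:E)%E; last by rewrite -EFinM exprS.
congr (_ * _)%E; last exact: IH.
rewrite lebesgue_measure_itv/= lte_fin; case: ifPn => [_|].
  by rewrite oppr0 adde0.
by rewrite -leNgt => r0'; congr (_%:E); apply/eqP; rewrite eq_le r0' r0.
Qed.

Lemma measurable_enorm (R : realType) (N : nat) :
  measurable_fun [set: 'rV[R]_N] (@enorm R N).
Proof.
apply: (@measurableT_comp _ _ _ _ _ _ (@Num.sqrt R)).
  by apply: continuous_measurable_fun; exact: sqrt_continuous.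
by apply: measurable_sum => i; apply: measurable_funM; exact: measurable_coord.
Qed.

(* direction of a vector; [direction 0 = 0] since [0^-1 = 0] *)
Definition direction (R : realType) (N : nat) (x : 'rV[R]_N) : 'rV[R]_N :=
  (enorm x)^-1 *: x.

Lemma measurable_direction (R : realType) (N : nat) :
  measurable_fun [set: 'rV[R]_N] (@direction R N).
Proof.
apply: measurable_fun_rVP => i.
under eq_fun do rewrite mxE -powR_inv1 ?sqrtr_ge0//.
apply: measurable_funM; last exact: measurable_coord.
exact: (measurableT_comp (measurable_powR (-1)) (@measurable_enorm R N)).
Qed.

(* Surface measure on S^{N-1}, through the polar decomposition of Lebesgue
   measure: |A| = N * Leb {x | 0 < |x| <= 1, x/|x| \in A}.  It is carried by
   the unit sphere. *)
Section surface_measure.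
Context {R : realType} (N : nat).
Local Open Scope ereal_scope.

Definition surface_measure (A : set 'rV[R]_N) : \bar R :=
  (N%:R)%:E * lebesgue_rV N
    [set x | (0 < enorm x <= 1)%R /\ A (direction x)].

Let cone (A : set 'rV[R]_N) :=
  [set x : 'rV[R]_N | (0 < enorm x <= 1)%R /\ A (direction x)].

Let measurable_cone A : measurable A -> measurable (cone A).
Proof.
move=> mA.
have -> : cone A = (@enorm R N @^-1` `]0%R, 1%R]) `&` (@direction R N @^-1` A).
  by apply/seteqP; split => x /=; rewrite in_itv.
apply: measurableI.
  by rewrite -[X in measurable X]setTI; exact: measurable_enorm.
by rewrite -[X in measurable X]setTI; exact: measurable_direction.
Qed.

Let surface_measure0 : surface_measure set0 = 0.
Proof.
rewrite /surface_measure (_ : [set _ | _] = set0) ?measure0 ?mule0//.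
by apply/seteqP; split => x // -[].
Qed.

Let surface_measure_ge0 A : 0 <= surface_measure A.
Proof. by rewrite mule_ge0// lee_fin. Qed.

Let surface_measure_sigma_additive : semi_sigma_additive surface_measure.
Proof.
move=> F mF tF mUF.
have coneU : cone (\bigcup_i F i) = \bigcup_i cone (F i).
  apply/seteqP; split => x.
    by move=> [xN [i _ Fi]]; exists i.
  by move=> [i _ [xN Fi]]; split => //; exists i.
have h : (fun n => \sum_(0 <= i < n) lebesgue_rV N (cone (F i))) @ \oo -->
    lebesgue_rV N (cone (\bigcup_i F i)).
  rewrite coneU; apply: measure_semi_sigma_additive.
  - by move=> i; exact: measurable_cone.
  - apply/trivIsetP => i j _ _ ij; apply/seteqP; split => x // [[_ Fi] [_ Fj]].
    have : (F i `&` F j) (direction x) by [].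
    by move/trivIsetP : tF => ->.
  - by rewrite -coneU; exact: measurable_cone.
rewrite /surface_measure -/(cone _).
rewrite (_ : (fun n => _) = (fun n => (N%:R)%:E *
    \sum_(0 <= i < n) lebesgue_rV N (cone (F i)))); last first.
  by apply/funext => n; rewrite ge0_sume_distrr.
exact: cvgeZl.
Qed.

HB.instance Definition _ := isMeasure.Build _ _ _ surface_measure
  surface_measure0 surface_measure_ge0 surface_measure_sigma_additive.

End surface_measure.

Section collision.
Context {R : realType} (N : nat).
Implicit Types (f : 'rV[R]_N -> R) (u v vs s : 'rV[R]_N).

(* b(u, sigma), [cN] being the normalizing constant c_N *)
Definition kernel_b (cN : R) (u s : 'rV[R]_N) : R :=
  cN * ((1 - dot (direction u) s) / 2) `^ (- ((N%:R - 3) / 2)).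

Definition kernel_normalized (cN : R) : Prop :=
  0 < cN /\ forall u : 'rV[R]_N, u != 0 ->
  (\int[@surface_measure R N]_(s in @sphere R N) (kernel_b cN u s)%:E = 1)%E.

(* 'u, 'v and 'v_* *)
Definition pre_u (alpha : R) (u s : 'rV[R]_N) : 'rV[R]_N :=
  let gamma := (1 + alpha) / (2 * alpha) in
  (1 - gamma) *: u + (gamma * enorm u) *: s.

Definition pre_v (alpha : R) (v vs s : 'rV[R]_N) : 'rV[R]_N :=
  2^-1 *: (v + vs) + 2^-1 *: pre_u alpha (v - vs) s.

Definition pre_vs (alpha : R) (v vs s : 'rV[R]_N) : 'rV[R]_N :=
  2^-1 *: (v + vs) - 2^-1 *: pre_u alpha (v - vs) s.

Local Open Scope ereal_scope.

Definition Qplus (alpha cN : R) f v : \bar R :=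
  \int[lebesgue_rV N]_vs \int[@surface_measure R N]_(s in @sphere R N)
    (f (pre_v alpha v vs s) * f (pre_vs alpha v vs s) *
     (alpha ^- 2 * enorm (v - vs) * kernel_b cN (v - vs) s))%:E.

Definition Qminus f v : \bar R :=
  (f v)%:E * \int[lebesgue_rV N]_vs (f vs * enorm (v - vs))%:E.

(* For f >= 0 both terms are well defined in [0, +oo]; an equation between Q
   and a finite quantity forces both to be finite, as the convention
   +oo - +oo = -oo is in force. *)
Definition Q (alpha cN : R) f v : \bar R := Qplus alpha cN f v - Qminus f v.

End collision.

(* [g] is of class C^k on the open set [U]: all iterated directional
   derivatives of order at most k exist and are continuous on [U]. *)
Fixpoint Ck_on (R : realType) (V : normedModType R) (k : nat) (U : set V)
    (g : V -> R) : Prop :=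
  (forall x, U x -> {for x, continuous g}) /\
  match k with
  | 0 => True
  | k'.+1 => forall w : V,
      (forall x, U x -> derivable g x w) /\ Ck_on k' U ('D_w g)
  end.

Definition smooth_on (R : realType) (V : normedModType R) (U : set V)
    (g : V -> R) : Prop := forall k, Ck_on k U g.

Definition laplacian (R : realType) (N : nat) (g : 'rV[R]_N -> R)
    (v : 'rV[R]_N) : R :=
  \sum_(i < N) 'D_('e_i) ('D_('e_i) g) v.

(* L^1_2(R^N), its norm, and L^oo([0, oo), L^1_2(R^N)) *)
Definition L12 (R : realType) (N : nat) (g : 'rV[R]_N -> R) : Prop :=
  (lebesgue_rV N).-integrable setT (fun v => (g v * (1 + enorm v ^+ 2))%:E).

Definition L12_norm (R : realType) (N : nat) (g : 'rV[R]_N -> R) : \bar R :=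
  (\int[lebesgue_rV N]_v (`|g v| * (1 + enorm v ^+ 2))%:E)%E.

Definition Linfty_L12 (R : realType) (N : nat) (f : R -> 'rV[R]_N -> R) : Prop :=
  exists M : R, {ae @lebesgue_measure R, forall t : R, 0 <= t ->
    L12 (f t) /\ (L12_norm (f t) <= M%:E)%E}.

(* Nonnegative classical solution of d_t f - Delta_v f = Q(f, f) with initial
   value f0: smooth for t > 0, continuous up to t = 0.  Only the values of
   [f t] for [0 <= t] matter. *)
Record smooth_solution (R : realType) (N : nat) (alpha cN : R)
    (f0 : 'rV[R]_N -> R) (f : R -> 'rV[R]_N -> R) : Prop := {
  sol_ge0 : forall (t : R) v, 0 <= t -> 0 <= f t v ;
  sol_smooth : smooth_on [set p : R * 'rV[R]_N | 0 < p.1]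
                 (fun p => f p.1 p.2) ;
  sol_continuous : {within [set p : R * 'rV[R]_N | 0 <= p.1],
                      continuous (fun p => f p.1 p.2)} ;
  sol_init : forall v, f 0 v = f0 v ;
  sol_eq : forall (t : R) v, 0 < t ->
    ('D_1 (fun s : R => f s v) t - laplacian (f t) v)%:E =
    Q alpha cN (f t) v
}.

(* Main.v *)
(* Dropping the gain term and bounding the loss frequency f * |v| by the mass
   and energy of f gives d_t f - Delta f >= - C <v> f pointwise, with
   <v> = (1 + |v|^2)^(1/2).  The barrier g = K exp(- b t - a <v - v0>^(3/2))
   satisfies the opposite inequality: in Delta g the term a^2 |grad phi|^2 g,
   with phi = <v - v0>^(3/2), grows like a^2 <v - v0> g and absorbs the loss for
   a large, except near v0.  There one either pays with b > 0, or knows that f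
   is bounded below (and takes b = 0).  Since g tends to 0 at infinity and
   f >= 0, a negative value of f - g would yield a negative minimum on
   [0, T] x R^N, where d_t (f - g) <= 0 <= Delta (f - g) contradicts the two
   inequalities. *)
Require Import Defs.
From mathcomp Require Import all_boot all_order all_algebra.
From mathcomp Require Import all_classical all_reals all_analysis.
From mathcomp Require Import measurable_realfun ring lra.

Set Implicit Arguments.
Unset Strict Implicit.
Unset Printing Implicit Defensive.
Import Order.TTheory GRing.Theory Num.Theory.
Import numFieldNormedType.Exports.
Local Open Scope classical_set_scope.
Local Open Scope ring_scope.

(** * First- and second-order conditions at a minimum, in one real variable *)

Lemma is_derive_gt0_slope (R : realType) (p : R -> R) (x d : R) :
  is_derive x 1 p d -> 0 < d ->
  exists2 e : R, 0 < e &
    forall h, h != 0 -> `|h| < e -> 0 < (p (x + h) - p x) / h.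
Proof.
move=> [dp pd] d0.
have : h^-1 *: ((p \o shift x) (h *: (1 : R)) - p x) @[h --> 0^'] --> d.
  by rewrite -pd; exact: dp.
move=> /cvgrPdist_lt /(_ _ d0) [e/= e0 he]; exists e => // h h0 hlt.
have /= := he h; rewrite sub0r normrN => /(_ hlt h0).
rewrite [_%:A]mulr1 [h + x]addrC [_ *: _]mulrC ltr_distlC => /andP[+ _].
rewrite subrr.
done.
Qed.

(** A positive derivative would make [p] smaller just to the left of [x]. Only earlier points are
    compared because in the comparison argument the minimum may sit at the final time. *)
Lemma left_min_derive_le0 (R : realType) (p : R -> R) (x d : R) : 0 < x ->
  is_derive x 1 p d -> (forall s, 0 <= s <= x -> p x <= p s) -> d <= 0.
Proof.
move=> x0 pd pmin; rewrite leNgt; apply/negP => d0.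
have [e e0 he] := is_derive_gt0_slope pd d0.
(* The cap by [x] keeps [x - h] in [[0, x]], where minimality is assumed. *)
pose h := Num.min (e / 2) x.
have h0 : 0 < h by rewrite lt_min x0 divr_gt0.
have hx : h <= x by rewrite ge_min lexx orbT.
have he2 : h < e.
  by rewrite (@le_lt_trans _ _ (e / 2)) ?ge_min ?lexx// ltr_pdivrMr// ltr_pMr// ltr1n.
have := he (- h); rewrite oppr_eq0 normrN gtr0_norm// => /(_ (lt0r_neq0 h0) he2).
rewrite invrN mulrN oppr_gt0 pmulr_llt0 ?invr_gt0// subr_lt0 ltNge pmin//.
by rewrite subr_ge0 hx /= gerBl ltW.
Qed.

(** At the minimum [dp x = 0]. If [d < 0], then [dp] is negative just to the right of [x], and the
    mean value theorem gives a value of [p] below [p x]. *)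
Lemma min_derive2_ge0 (R : realType) (p dp : R -> R) (x d : R) :
  (forall s : R, is_derive s 1 p (dp s)) -> is_derive x 1 dp d ->
  (forall s, p x <= p s) -> 0 <= d.
Proof.
move=> pd dpd pmin; rewrite leNgt; apply/negP => d0.
have dp0 : dp x = 0.
  have xI : x \in `](x - 1), (x + 1)[ by rewrite in_itv/=; apply/andP; split; lra.
  have [] : is_derive x 1 p 0.
    by apply: (derive1_at_min _ _ xI) => [|t _|t _]; [lra|have [] := pd t|exact: pmin].
  by move=> _ <-; have [_ ->] := pd x.
have Nd : is_derive x 1 (- dp) (- d) by apply: is_deriveN.
have [e e0 he] : exists2 e : R, 0 < e & forall h, h != 0 -> `|h| < e ->
    0 < ((- dp) (x + h) - (- dp) x) / h.
  by apply: is_derive_gt0_slope Nd _; rewrite oppr_gt0.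
have cp : {within `[x, x + e / 2], continuous p}.
  by apply: derivable_within_continuous => y _; have [] := pd y.
have xe : x < x + e / 2 by rewrite ltrDl divr_gt0.
have [y] := MVT xe (fun y _ => pd y) cp.
rewrite in_itv/= => /andP[xy ye] E.
have := he (y - x); rewrite subr_eq0 gt_eqF// gtr0_norm ?subr_gt0//.
have -> : x + (y - x) = y by lra.
move=> /(_ isT); rewrite !(_ : forall r, (- dp) r = - dp r)// dp0 oppr0 subr0.
have ye2 : y - x < e by lra.
move=> /(_ ye2); rewrite pmulr_lgt0 ?invr_gt0 ?subr_gt0// oppr_gt0 => dy.
have := pmin (x + e / 2); rewrite -subr_ge0 E.
have -> : x + e / 2 - x = e / 2 by lra.
by rewrite pmulr_lge0 ?divr_gt0// leNgt dy.
Qed.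

(** * Derivatives along lines and of slices of a function on a product *)

Lemma is_derive_line (R : realType) (V : normedModType R) (G : V -> R)
    (a w : V) (s : R) : derivable G (s *: w + a) w ->
  is_derive s 1 (fun r : R => G (r *: w + a)) ('D_w G (s *: w + a)).
Proof.
have E : (fun h : R => h^-1 *: (((fun r : R => G (r *: w + a)) \o shift s) (h *: (1 : R))
      - G (s *: w + a))) =
    (fun h : R => h^-1 *: ((G \o shift (s *: w + a)) (h *: w) - G (s *: w + a))).
  by apply/funext => h /=; rewrite [_%:A]mulr1 scalerDl addrA.
by move=> dG; split; rewrite /derivable /derive E.
Qed.

(** Smoothness is stated for functions of the pair (t, v), the equation for slices in v. The two
    difference quotients are the same function of [h], so derivability and derivative both
    transfer. *)
Lemma pair_difference_quotient (R : realType) (V : normedModType R)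
    (G : R * V -> R) (t : R) (v w : V) :
  (fun h : R => h^-1 *:
    (((fun x => G (t, x)) \o shift v) (h *: w) - G (t, v))) =
  (fun h : R => h^-1 *:
    ((G \o shift (t, v)) (h *: ((0, w) : R * V)) - G (t, v))).
Proof.
apply/funext => h /=; congr (_ *: (G _ - _)).
by apply: injective_projections => //=; rewrite scaler0 add0r.
Qed.

Lemma derive_pair (R : realType) (V : normedModType R) (G : R * V -> R)
    (t : R) (v w : V) :
  'D_w (fun x => G (t, x)) v = 'D_((0, w) : R * V) G (t, v).
Proof. by rewrite /derive pair_difference_quotient. Qed.

Lemma derivable_pair (R : realType) (V : normedModType R) (G : R * V -> R)
    (t : R) (v w : V) :
  derivable G (t, v) ((0, w) : R * V) -> derivable (fun x => G (t, x)) v w.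
Proof. by rewrite /derivable pair_difference_quotient. Qed.

(** * The weight <v>^2 = 1 + |v|^2 *)

(** The square of the bracket <v>, so that it is a quadratic polynomial along every line; <v> and
    <v>^(3/2) are its powers 1/2 and 3/4. *)
Definition japanese_sq (R : realType) (N : nat) (v : 'rV[R]_N) : R :=
  1 + dot v v.

Lemma dot_ge0 (R : realType) (N : nat) (v : 'rV[R]_N) : 0 <= dot v v.
Proof. by apply: sumr_ge0 => i _; rewrite -expr2 sqr_ge0. Qed.

Lemma sqr_enorm (R : realType) (N : nat) (v : 'rV[R]_N) :
  enorm v ^+ 2 = dot v v.
Proof. by rewrite sqr_sqrtr// dot_ge0. Qed.

Lemma japanese_sq_ge1 (R : realType) (N : nat) (v : 'rV[R]_N) :
  1 <= japanese_sq v.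
Proof. by rewrite lerDl dot_ge0. Qed.

Lemma japanese_sq_gt0 (R : realType) (N : nat) (v : 'rV[R]_N) :
  0 < japanese_sq v.
Proof. exact: lt_le_trans ltr01 (japanese_sq_ge1 v). Qed.

Lemma japanese_sqN (R : realType) (N : nat) (v : 'rV[R]_N) :
  japanese_sq (- v) = japanese_sq v.
Proof.
by congr (1 + _); apply: eq_bigr => i _; rewrite !mxE mulrNN.
Qed.

(* Peetre's inequality. *)
Lemma japanese_sqD (R : realType) (N : nat) (v w : 'rV[R]_N) :
  japanese_sq (v + w) <= 2 * japanese_sq v * japanese_sq w.
Proof.
have : dot (v + w) (v + w) <= 2 * dot v v + 2 * dot w w.
  rewrite !mulr_sumr -big_split/=; apply: ler_sum => i _; rewrite !mxE.
  by have := sqr_ge0 (v ord0 i - w ord0 i); rewrite expr2; lra.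
rewrite /japanese_sq; have := dot_ge0 v; have := dot_ge0 w.
by move: (dot v v) (dot w w) (dot _ _) => a b c; nra.
Qed.

(** Peetre's inequality gives |v - w|^2 <= 2 <v>^2 <w>^2, and <w> >= 1. The variables are thereby
    separated: <v> is the growth of the loss frequency, <w>^2 the weight of L^1_2. *)
Lemma enormB_le (R : realType) (N : nat) (v w : 'rV[R]_N) :
  enorm (v - w) <= 2 * Num.sqrt (japanese_sq v) * japanese_sq w.
Proof.
have v1 := japanese_sq_ge1 v; have w1 := japanese_sq_ge1 w.
rewrite -(ler_pXn2r (ltn0Sn 1)) ?nnegrE ?sqrtr_ge0//; last first.
  by rewrite !mulr_ge0 ?sqrtr_ge0// (le_trans ler01).
rewrite sqr_enorm !exprMn sqr_sqrtr ?(le_trans ler01)//.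
have := japanese_sqD v (- w); rewrite japanese_sqN {1}/japanese_sq => h.
apply: (@le_trans _ _ (2 * japanese_sq v * japanese_sq w)); first lra.
have : 0 <= japanese_sq v * (japanese_sq w * (japanese_sq w - 1)).
  by rewrite !mulr_ge0//; lra.
have : 0 <= japanese_sq v * japanese_sq w by rewrite mulr_ge0//; lra.
by rewrite expr2; lra.
Qed.

Lemma measurable_japanese_sq (R : realType) (N : nat) :
  measurable_fun setT (@japanese_sq R N).
Proof.
rewrite (_ : @japanese_sq R N = fun v => 1 + enorm v ^+ 2); last first.
  by apply/funext => v; rewrite sqr_enorm.
by apply: measurable_funD => //; apply: measurable_funX; exact: measurable_enorm.
Qed.

(** * From a moment bound at almost every time to every positive time *)

(** A null set cannot contain an interval of positive length. *)
Lemma ae_exists_itv (R : realType) (P : R -> Prop) (a b : R) : a < b ->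
  {ae @lebesgue_measure R, forall t, P t} -> exists2 t, a < t < b & P t.
Proof.
move=> ab [A [mA A0 PA]]; apply: contrapT => nP.
have sub : `]a, b[%classic `<=` A.
  move=> t /=; rewrite in_itv/= => tab; apply: PA => /= Pt.
  by apply: nP; exists t.
have : (lebesgue_measure `]a, b[%classic <= 0 :> \bar R)%E.
  by rewrite -A0; apply: le_measure; rewrite ?inE.
by rewrite lebesgue_measure_itv/= lte_fin ab -EFinB lee_fin leNgt subr_gt0 ab.
Qed.

(* Fatou's lemma along times decreasing to [t] at which the bound holds. *)
Lemma Linfty_L12_pointwise (R : realType) (N : nat) (f : R -> 'rV[R]_N -> R) :
  Linfty_L12 f -> (forall t v, 0 <= t -> 0 <= f t v) ->
  (forall t v, 0 < t -> {for t, continuous (f^~ v)}) ->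
  exists M : R, forall t, 0 < t -> measurable_fun setT (f t) /\
    (\int[lebesgue_rV N]_v (f t v * japanese_sq v)%:E <= M%:E)%E.
Proof.
move=> [M fM] f0 fc; exists M => t t0.
have inv n : t < t + n.+1%:R^-1 by rewrite ltrDl invr_gt0.
have /choice[s sP] : forall n, exists s, t < s < t + n.+1%:R^-1 /\
    (0 <= s -> L12 (f s) /\ (L12_norm (f s) <= M%:E)%E).
  by move=> n; have [s] := ae_exists_itv (inv n) fM; exists s.
have s0 n : 0 <= s n.
  by have [/andP[ts _] _] := sP n; exact: ltW (lt_trans t0 ts).
have mJ := @measurable_japanese_sq R N.
have jE (g : 'rV[R]_N -> R) v : g v * (1 + enorm v ^+ 2) = g v * japanese_sq v.
  by rewrite sqr_enorm.
have mfJ n : measurable_fun setT (fun v => f (s n) v * japanese_sq v).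
  have [_ /(_ (s0 n))[/measurable_int/measurable_EFinP + _]] := sP n.
  by move=> mf; under eq_fun do rewrite -jE.
have st : s n @[n --> \oo] --> t.
  apply: (@squeeze_cvgr _ _ _ _ (cst t) (fun n => t + n.+1%:R^-1)).
  - by apply: nearW => n; have [/andP[/ltW -> /ltW ->]] := sP n.
  - exact: cvg_cst.
  - rewrite -[X in _ --> X]addr0; apply: cvgD; first exact: cvg_cst.
    exact: cvg_harmonic.
have fst v : f (s n) v @[n --> \oo] --> f t v.
  exact: (cvg_comp _ _ st (fc _ v t0)).
split.
  apply: (@measurable_fun_cvg _ _ _ _ (fun n v => f (s n) v)) => [n|v _]; last exact: fst.
  (* Integrability gives measurability of the weighted function; the weight is divided out again, as
     a power -1. *)
  rewrite (_ : f (s n) = fun v => (f (s n) v * japanese_sq v) * japanese_sq v `^ (-1)).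
    apply: measurable_funM => //.
    by apply: (measurableT_comp (measurable_powR (-1))).
  apply/funext => v; rewrite powR_inv1; last exact: ltW (japanese_sq_gt0 v).
  by rewrite mulfK// gt_eqF// japanese_sq_gt0.
pose F n v := (f (s n) v * japanese_sq v)%:E.
have F0 n v : (0 <= F n v)%E.
  by rewrite lee_fin mulr_ge0 ?f0// ltW// japanese_sq_gt0.
have := @fatou _ _ _ (lebesgue_rV N) _ (measurableT) F.
move=> /(_ (fun n => measurableT_comp (@EFin_measurable _ _) (mfJ n)) (fun n v _ => F0 n v)).
have -> : (fun v => limn_einf (F^~ v)) = (fun v => (f t v * japanese_sq v)%:E).
  apply/funext => v; apply: (cvg_limn_einf_sup _).1.
  apply: cvg_EFin; first exact: nearW.
  by apply: cvgMl; exact: fst.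
move=> /le_trans; apply; rewrite limn_einf_lim.
apply: lime_le; first exact: is_cvg_einfs.
apply: nearW => n.
apply: (@le_trans _ _ (\int[lebesgue_rV N]_v F n v)%E).
  by apply: ereal_inf_lbound; exists n => /=.
have [_ /(_ (s0 n))[_ +]] := sP n; apply: le_trans.
rewrite /L12_norm le_eqVlt; apply/orP; left; apply/eqP; apply: eq_integral => v _.
by rewrite ger0_norm ?f0// jE.
Qed.

(** * Lower bound for the collision operator *)

Lemma kernel_b_ge0 (R : realType) (N : nat) (cN : R) (u s : 'rV[R]_N) :
  0 < cN -> 0 <= kernel_b cN u s.
Proof. by move=> cN0; rewrite mulr_ge0 ?powR_ge0 1?ltW. Qed.

(** The gain term is nonnegative. In the loss term [enormB_le] bounds |v - w| by 2 <v> <w>^2, and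
    integrating in w leaves the factor M. *)
Lemma Q_lower_bound (R : realType) (N : nat) (alpha cN M : R)
    (g : 'rV[R]_N -> R) (v : 'rV[R]_N) (q : R) :
  0 < alpha -> 0 < cN -> (forall w, 0 <= g w) -> measurable_fun setT g ->
  (\int[lebesgue_rV N]_w (g w * japanese_sq w)%:E <= M%:E)%E ->
  q%:E = Q alpha cN g v -> - (2 * M * Num.sqrt (japanese_sq v)) * g v <= q.
Proof.
move=> alpha0 cN0 g0 mg gM qE; rewrite -lee_fin qE /Q.
have mJ := @measurable_japanese_sq R N.
have Qp : (0 <= Qplus alpha cN g v)%E.
  apply: integral_ge0 => w _; apply: integral_ge0 => s _.
  rewrite lee_fin; apply: mulr_ge0; first exact: mulr_ge0.
  apply: mulr_ge0; last exact: kernel_b_ge0.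
  by rewrite mulr_ge0 ?sqrtr_ge0// invr_ge0 exprn_ge0// ltW.
have le1 : (\int[lebesgue_rV N]_w (g w * enorm (v - (w : 'rV[R]_N)))%:E <=
    (2 * Num.sqrt (japanese_sq v))%:E *
    \int[lebesgue_rV N]_w (g w * japanese_sq w)%:E)%E.
  have mE : measurable_fun setT (fun w : 'rV[R]_N => enorm (v - w)).
    apply: (measurableT_comp (@measurable_enorm R N)).
    apply: measurable_fun_rVP => i; under eq_fun do rewrite !mxE.
    by apply: measurable_funB => //; exact: measurable_coord.
  rewrite -ge0_integralZl//; last 2 first.
  - by apply/measurable_EFinP; exact: measurable_funM.
  - by move=> w _; rewrite lee_fin mulr_ge0// ltW// japanese_sq_gt0.
  apply: ge0_le_integral => //.
  - by move=> w _; rewrite lee_fin mulr_ge0 ?sqrtr_ge0.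
  - by apply/measurable_EFinP; exact: measurable_funM.
  - by apply/measurable_EFinP; do 2 apply: measurable_funM => //.
  - by move=> w _; rewrite lee_fin mulrCA ler_wpM2l// enormB_le.
have Qm : (Qminus g v <= (2 * M * Num.sqrt (japanese_sq v) * g v)%:E)%E.
  rewrite /Qminus.
  have -> : 2 * M * Num.sqrt (japanese_sq v) * g v =
    g v * (2 * Num.sqrt (japanese_sq v) * M) by ring.
  rewrite EFinM lee_wpmul2l ?lee_fin//; apply: le_trans le1 _.
  by rewrite [leRHS]EFinM lee_wpmul2l// lee_fin mulr_ge0 ?sqrtr_ge0.
by rewrite mulNr EFinN -[leLHS]add0e; apply: leeB.
Qed.

(** * Derivatives of the barrier along coordinate lines, and its Laplacian *)

Lemma is_derive_expR_powR (R : realType) (A a c : R) (q dq : R -> R) (s : R) :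
  0 < q s -> is_derive s 1 q (dq s) ->
  is_derive s 1 (fun r => A * expR (- (a * q r `^ c)))
    (- (a * c * q s `^ (c - 1) * dq s) * (A * expR (- (a * q s `^ c)))).
Proof.
move=> q0 dq'.
have h1 : is_derive s 1 (fun r => q r `^ c) (c * q s `^ (c - 1) * dq s).
  exact: (is_derive1_comp (is_derive1_powR c q0) dq').
have h2 : is_derive s 1 (fun r => - (a * q r `^ c)) (- (a * (c * q s `^ (c - 1) * dq s))).
  exact: is_deriveN (is_deriveZ a h1).
have h3 : is_derive s 1 (fun r => expR (- (a * q r `^ c)))
    (expR (- (a * q s `^ c)) * - (a * (c * q s `^ (c - 1) * dq s))).
  exact: (is_derive1_comp (is_derive_expR _) h2).
have := is_deriveZ A h3; congr is_derive; rewrite /GRing.scale/=; ring.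
Qed.

(** With phi = q^c the factor is (a phi')^2 - a phi''; the square is the part that later absorbs the
    loss term. *)
Lemma is_derive2_expR_powR (R : realType) (A a c e : R) (q dq : R -> R) (s : R) :
  0 < q s -> is_derive s 1 q (dq s) -> is_derive s 1 dq e ->
  is_derive s 1
    (fun r => - (a * c * q r `^ (c - 1) * dq r) * (A * expR (- (a * q r `^ c))))
    (((a * c * q s `^ (c - 1) * dq s) ^+ 2 -
      a * c * ((c - 1) * q s `^ (c - 1 - 1) * dq s ^+ 2 + q s `^ (c - 1) * e)) *
     (A * expR (- (a * q s `^ c)))).
Proof.
move=> q0 dq' ddq.
have h1 : is_derive s 1 (fun r => q r `^ (c - 1)) ((c - 1) * q s `^ (c - 1 - 1) * dq s).
  exact: (is_derive1_comp (is_derive1_powR _ q0) dq').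
have h2 : is_derive s 1 (fun r => q r `^ (c - 1) * dq r)
    (q s `^ (c - 1) * e + dq s * ((c - 1) * q s `^ (c - 1 - 1) * dq s)).
  exact: is_deriveM h1 ddq.
have h3 : is_derive s 1 (fun r => - (a * c) * (q r `^ (c - 1) * dq r))
    (- (a * c) * (q s `^ (c - 1) * e + dq s * ((c - 1) * q s `^ (c - 1 - 1) * dq s))).
  exact: is_deriveZ h2.
under eq_fun do rewrite -[a * c * _ * _]mulrA -mulNr.
have h4 := is_deriveM h3 (is_derive_expR_powR A a c q0 dq').
apply: (is_derive_eq h4); rewrite /GRing.scale/=; ring.
Qed.

(* [japanese_sq ^ (3/4)] is a smooth substitute for [|v| ^ (3/2)]. *)
Definition barrier (R : realType) (N : nat) (A a : R) (v0 v : 'rV[R]_N) : R :=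
  A * expR (- (a * japanese_sq (v - v0) `^ (3 / 4))).

Lemma dot_delta (R : realType) (N : nat) (i : 'I_N) (w : 'rV[R]_N) (s : R) :
  dot (s *: 'e_i + w) (s *: 'e_i + w) = dot w w + s * 2 * w ord0 i + s ^+ 2.
Proof.
rewrite /dot (bigD1 i)//= [X in _ = X + _ + _](bigD1 i)//= !mxE eqxx/=.
rewrite [X in _ + X = _](eq_bigr (fun j => w ord0 j * w ord0 j)); first by ring.
by move=> j /negbTE ji; rewrite !mxE ji/= mulr0 add0r.
Qed.

(** At a global minimum of the difference every pure second derivative of [g] dominates that of the
    barrier, so the bound is proved coordinate by coordinate and summed. *)
Lemma laplacian_ge_barrier (R : realType) (N : nat) (A a : R)
    (v0 v : 'rV[R]_N) (g : 'rV[R]_N -> R) :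
  0 <= A -> 0 <= a ->
  (forall i x, derivable g x 'e_i) ->
  (forall i x, derivable ('D_('e_i) g) x 'e_i) ->
  (forall x, g v - barrier A a v0 v <= g x - barrier A a v0 x) ->
  (9 / 4 * a ^+ 2 * (dot (v - v0) (v - v0) / Num.sqrt (japanese_sq (v - v0))) -
   3 / 2 * a * N%:R) * barrier A a v0 v <= laplacian g v.
Proof.
move=> A0 a0 dg ddg gmin.
pose w := v - v0; pose J := japanese_sq w.
have J1 : 1 <= J := japanese_sq_ge1 w.
have J0 : 0 < J := japanese_sq_gt0 w.
have B0 : 0 <= barrier A a v0 v by rewrite mulr_ge0 ?expR_ge0.
(* Along ['e_i] one has phi' = (3/2) w_i J^(-1/4), whose square is (9/4) w_i^2 / sqrt J. *)
have P2 : (J `^ (3 / 4 - 1)) ^+ 2 = (Num.sqrt J)^-1.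
  rewrite -powR_mulrn ?powR_ge0// -powRrM -powR12_sqrt ?ltW// -powRN.
  by congr (_ `^ _); lra.
have P1 : J `^ (3 / 4 - 1) <= 1.
  by rewrite -[leRHS](powRr0 J) ler_powR//; lra.
have -> : (9 / 4 * a ^+ 2 * (dot w w / Num.sqrt J) - 3 / 2 * a * N%:R) * barrier A a v0 v =
    \sum_(i < N) (9 / 4 * a ^+ 2 * (w ord0 i ^+ 2 / Num.sqrt J) - 3 / 2 * a) * barrier A a v0 v.
  rewrite -mulr_suml; congr (_ * _).
  rewrite big_split/= sumr_const card_ord -[X in _ = _ + X]mulr_natr mulNr -mulr_sumr -mulr_suml.
  by congr (_ * (_ / _) - _); apply: eq_bigr => i _; rewrite expr2.
apply: ler_sum => i _.
pose q s := J + s * 2 * w ord0 i + s ^+ 2.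
pose dq s := 2 * w ord0 i + 2 * s.
have qE s : japanese_sq (s *: 'e_i + v - v0) = q s.
  by rewrite /japanese_sq -addrA dot_delta /q /J /japanese_sq; ring.
have q0 s : 0 < q s by rewrite -qE japanese_sq_gt0.
have dqE (s : R) : is_derive s 1 q (dq s).
  rewrite /q; apply: is_derive_eq.
  rewrite /dq /GRing.scale/=; ring.
have ddqE (s : R) : is_derive s 1 dq 2.
  by rewrite /dq; apply: is_derive_eq; rewrite /GRing.scale/=; ring.
pose p s := g (s *: 'e_i + v) - barrier A a v0 (s *: 'e_i + v).
have pE : p = (fun s => g (s *: 'e_i + v)) - (fun s => A * expR (- (a * q s `^ (3 / 4)))).
  by apply/funext => s; rewrite /p /barrier qE.
have dp s := is_deriveB (is_derive_line (dg i (s *: 'e_i + v)))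
  (is_derive_expR_powR A a (3 / 4) (q0 s) (dqE s)).
rewrite -pE in dp.
have ddp := is_deriveB (is_derive_line (ddg i (0 *: 'e_i + v)))
  (is_derive2_expR_powR A a (3 / 4) (q0 0) (dqE 0) (ddqE 0)).
have := min_derive2_ge0 dp ddp.
rewrite scale0r add0r.
have -> : A * expR (- (a * q 0 `^ (3 / 4))) = barrier A a v0 v.
  by rewrite -qE scale0r add0r.
have -> : q 0 = J by rewrite /q; ring.
have -> : dq 0 = 2 * w ord0 i by rewrite /dq; ring.
have pmin s : p 0 <= p s by rewrite /p scale0r add0r; exact: gmin.
move=> /(_ pmin); rewrite subr_ge0; apply: le_trans; apply: (ler_wpM2r B0).
rewrite -P2.
move: P1 (powR_ge0 J (3 / 4 - 1)) (powR_ge0 J (3 / 4 - 1 - 1)).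
move: (J `^ _) (J `^ _) => S P P1 P0 S0.
clear -a0 P1 P0 S0.
(* In - a phi'' the term with J^(-5/4) is nonnegative, because 3/4 - 1 < 0, and is dropped; the
   other is at least - (3/2) a since J^(-1/4) <= 1. *)
have : 0 <= a * (S * w ord0 i ^+ 2) by rewrite mulr_ge0// mulr_ge0// sqr_ge0.
have : 0 <= a * (1 - P) by rewrite mulr_ge0// subr_ge0.
by rewrite !exprMn; lra.
Qed.

(** * Continuity, positivity and decay of the barrier *)

Lemma continuous_barrier (R : realType) (N : nat) (K b a : R)
    (v0 : 'rV[R]_N) :
  continuous (fun p : R * 'rV[R]_N => barrier (K * expR (- b * p.1)) a v0 p.2).
Proof.
move=> p; rewrite /barrier.
have c1 : {for p, continuous (fun r : R * 'rV[R]_N => r.1)} by exact: cvg_fst.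
have cq : {for p, continuous (fun r : R * 'rV[R]_N => japanese_sq (r.2 - v0))}.
  apply: cvgD; first exact: cvg_cst.
  apply: cvg_big; first exact: add_continuous.
  move=> i _.
  have ci : {for p, continuous (fun r : R * 'rV[R]_N => (r.2 - v0) ord0 i)}.
    have -> : (fun r : R * 'rV[R]_N => (r.2 - v0) ord0 i) =
        fun r => r.2 ord0 i - v0 ord0 i.
      by apply/funext => r; rewrite !mxE.
    apply: cvgB; last exact: cvg_cst.
    have c2 : (fun r : R * 'rV[R]_N => r.2) r @[r --> p] --> p.2 by exact: cvg_snd.
    exact: (cvg_comp _ _ c2 (@coord_continuous _ _ _ ord0 i p.2)).
  exact: (cvgM ci ci).
have cJ : {for japanese_sq (p.2 - v0), continuous (fun x : R => x `^ (3 / 4))}.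
  apply/differentiable_continuous/derivable1_diffP.
  by have [] := is_derive1_powR (3 / 4) (japanese_sq_gt0 (p.2 - v0)).
have cJq := cvg_comp _ _ cq cJ.
have cE (u : R * 'rV[R]_N -> R) : {for p, continuous u} ->
    {for p, continuous (fun r => expR (u r))}.
  by move=> cu; exact: (cvg_comp _ _ cu (@continuous_expR _ (u p))).
apply: cvgM.
  apply: cvgM; first exact: cvg_cst.
  by apply: cE; apply: cvgM => //; exact: cvg_cst.
apply: cE; apply: cvgN; apply: cvgM; [exact: cvg_cst|exact: cJq].
Qed.

Lemma barrier_gt0 (R : realType) (N : nat) (A a : R) (v0 v : 'rV[R]_N) :
  0 < A -> 0 < barrier A a v0 v.
Proof. by move=> A0; rewrite mulr_gt0 ?expR_gt0. Qed.

(** |w_i| <= <w> <= <w>^(3/2), as <w> >= 1. One large coordinate thus makes the barrier small, which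
    suits the compact boxes used below. *)
Lemma japanese_sq_coord (R : realType) (N : nat) (w : 'rV[R]_N) (i : 'I_N) :
  `|w ord0 i| <= japanese_sq w `^ (3 / 4).
Proof.
have J1 := japanese_sq_ge1 w.
apply: (@le_trans _ _ (Num.sqrt (japanese_sq w))).
  rewrite -sqrtr_sqr ler_wsqrtr// /japanese_sq /dot (bigD1 i)//= expr2.
  have : 0 <= \sum_(j < N | j != i) w ord0 j * w ord0 j.
    by apply: sumr_ge0 => j _; rewrite -expr2 sqr_ge0.
  lra.
by rewrite -powR12_sqrt ?ler_powR ?(le_trans ler01)//; lra.
Qed.

(** Follows from d exp(a x) >= d (1 + a x) > A, where x = <v - v0>^(3/2) >= |(v - v0)_i|. *)
Lemma barrier_box (R : realType) (N : nat) (A a d : R) (v0 v : 'rV[R]_N) :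
  0 <= A -> 0 < a -> 0 < d ->
  (exists i, A / (a * d) < `|(v - v0) ord0 i|) -> barrier A a v0 v < d.
Proof.
move=> A0 a0 d0 [i]; rewrite ltr_pdivrMr ?mulr_gt0// => Ai.
have := japanese_sq_coord (v - v0) i; rewrite /barrier expRN.
move: (_ `^ _) => x ix.
rewrite ltr_pdivrMr ?expR_gt0//.
have : 0 <= (x - `|(v - v0) ord0 i|) * (a * d).
  by rewrite mulr_ge0 ?subr_ge0// mulr_ge0 ?ltW.
have : d * (1 + a * x) <= d * expR (a * x).
  by rewrite ler_wpM2l ?expR_ge1Dx// ltW.
lra.
Qed.

(** * Comparison principle *)

(** The arithmetic at the minimum, with [D] the time derivative, [L] the Laplacian, [r] the solution
    and [beta] the barrier: - c r <= D - L <= - (b + x - y) beta <= - c beta, against r < beta. *)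
Lemma min_contradiction (R : realType) (b c x y L D beta r : R) :
  0 < c -> r < beta -> 0 < beta ->
  (x - y) * beta <= L -> D <= - b * beta -> - c * r <= D - L ->
  c + y <= b + x -> False.
Proof.
move=> c0 rbeta beta0 xyL Db DL cyx.
have : 0 < c * (beta - r) by rewrite mulr_gt0// subr_gt0.
have : 0 <= (b + x - (c + y)) * beta by rewrite mulr_ge0 ?subr_ge0// ltW.
lra.
Qed.

(** The last hypothesis, which makes the barrier a subsolution, is asked only where [F] lies below
    the barrier. A known lower bound on a ball can therefore exempt that ball. *)
Lemma barrier_comparison (R : realType) (N : nat) (F : R -> 'rV[R]_N -> R)
    (C K b a : R) (v0 : 'rV[R]_N) :
  0 < C -> 0 < K -> 0 <= b -> 0 < a ->
  (forall t v, 0 <= t -> 0 <= F t v) ->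
  {within [set p : R * 'rV[R]_N | 0 <= p.1], continuous (fun p => F p.1 p.2)} ->
  (forall t v, 0 < t -> derivable (F^~ v) t 1) ->
  (forall t i v, 0 < t -> derivable (F t) v 'e_i) ->
  (forall t i v, 0 < t -> derivable ('D_('e_i) (F t)) v 'e_i) ->
  (forall t v, 0 < t -> - (C * Num.sqrt (japanese_sq v)) * F t v <=
     'D_1 (F^~ v) t - laplacian (F t) v) ->
  (forall v, barrier K a v0 v <= F 0 v) ->
  (forall t v, 0 < t -> F t v < barrier (K * expR (- b * t)) a v0 v ->
     C * Num.sqrt (japanese_sq v) + 3 / 2 * a * N%:R <=
     b + 9 / 4 * a ^+ 2 * (dot (v - v0) (v - v0) / Num.sqrt (japanese_sq (v - v0)))) ->
  forall t v, 0 < t -> barrier (K * expR (- b * t)) a v0 v <= F t v.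
Proof.
move=> C0 K0 b0 a0 F0 cF dF1 dF ddF Fsuper Finit Bsub t1 v1 t10.
pose B (p : R * 'rV[R]_N) := barrier (K * expR (- b * p.1)) a v0 p.2.
pose h p := F p.1 p.2 - B p.
rewrite leNgt; apply/negP => FB.
pose d := B (t1, v1) - F t1 v1.
have d0 : 0 < d by rewrite subr_gt0.
(* The threshold of [barrier_box]: since exp(- b t) <= 1, the barrier is below [d] outside the box
   at all times t >= 0, so there h > - d. *)
pose rho := K / (a * d).
pose box := [set v : 'rV[R]_N | forall i, `[v0 ord0 i - rho, v0 ord0 i + rho]%classic (v ord0 i)].
have cbox : compact box.
  by apply: (@rV_compact _ _ (fun i => `[v0 ord0 i - rho, v0 ord0 i + rho]%classic)) => i;
    exact: segment_compact.
have out t v : 0 <= t -> ~ box v -> - d < h (t, v).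
  move=> t0 /existsNP[i /=]; rewrite in_itv/= => /negP.
  rewrite -ler_distl -ltNge => vi.
  rewrite ltrBDr; apply: (@lt_le_trans _ _ 0); last exact: F0.
  rewrite addrC subr_lt0; apply: barrier_box => //.
    by rewrite mulr_ge0 ?expR_ge0// ltW.
  exists i; rewrite !mxE; apply: le_lt_trans vi.
  apply: ler_wpM2r; first by rewrite invr_ge0 mulr_ge0 ?(ltW a0) ?(ltW d0).
  apply: ler_piMr; first exact: ltW.
  by rewrite -[leRHS]expR0 ler_expR mulNr oppr_le0 mulr_ge0.
have hd : h (t1, v1) = - d by rewrite /h /d opprB.
have box1 : box v1.
  by apply: contrapT => /(out t1 v1 (ltW t10)); rewrite hd ltxx.
pose A := `[0, t1]%classic `*` box.
have cA : compact A by apply: compact_setX => //; exact: segment_compact.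
have A1 : A (t1, v1) by split => //=; rewrite in_itv/= lexx ltW.
have ch : {within A, continuous h}.
  move=> p; apply: cvgB.
    have sA : A `<=` [set p : R * 'rV[R]_N | 0 <= p.1].
      by move=> [t v] [/=]; rewrite in_itv/= => /andP[].
    exact: (continuous_subspaceW sA cF).
  apply: continuous_subspaceT; exact: continuous_barrier.
have [[t v] [/=]] : exists2 p, A p & forall p', A p' -> h p <= h p'.
  have [p Ap hp] := compact_EVT_min (ex_intro _ _ A1) cA ch.
  by exists p; [rewrite inE in Ap|move=> p' Ap'; apply: hp; rewrite inE].
rewrite in_itv/= => /andP[t0 tt1] bv hmin.
have htd : h (t, v) <= - d by rewrite -hd; exact: hmin.
(* The minimum over the box is a minimum over the whole space up to time [t], since outside the box
   h > - d >= h (t, v). *)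
have hglob s w : 0 <= s <= t -> h (t, v) <= h (s, w).
  move=> /andP[s0 st]; have [bw|nbw] := pselect (box w).
    by apply: hmin; split => //=; rewrite in_itv/= s0 (le_trans st).
  by apply: le_trans htd _; exact: ltW (out _ _ s0 nbw).
have FtB : F t v < B (t, v).
  by rewrite -subr_lt0; apply: le_lt_trans htd _; rewrite oppr_lt0.
(* At time 0 the initial comparison excludes F < B. *)
have {}t0 : 0 < t.
  rewrite lt_neqAle t0 andbT; apply/eqP => t0E.
  move: FtB; rewrite -t0E /B/= mulr0 expR0 mulr1 ltNge => /negP; apply.
  exact: Finit.
have Bgt0 : 0 < B (t, v) by rewrite barrier_gt0// mulr_gt0 ?expR_gt0.
have lap : (9 / 4 * a ^+ 2 * (dot (v - v0) (v - v0) / Num.sqrt (japanese_sq (v - v0))) -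
   3 / 2 * a * N%:R) * B (t, v) <= laplacian (F t) v.
  apply: laplacian_ge_barrier.
  - by rewrite mulr_ge0 ?expR_ge0// ltW.
  - exact: ltW.
  - by move=> i x; exact: dF.
  - by move=> i x; exact: ddF.
  - by move=> x; apply: hglob; rewrite ltW/=.
have dt : 'D_1 (F^~ v) t <= - b * B (t, v).
  have d1 : is_derive t 1 (F^~ v) ('D_1 (F^~ v) t) by split => //; exact: dF1.
  pose E := expR (- (a * japanese_sq (v - v0) `^ (3 / 4))).
  have d2 : is_derive t 1 (fun s => B (s, v)) (- b * B (t, v)).
    have e1 : is_derive t 1 (fun s : R => - b * s) (- b * 1) := is_deriveZ (- b) (is_derive_id t 1).
    have e2 : is_derive t 1 (fun s : R => expR (- b * s)) (expR (- b * t) * (- b * 1)).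
      exact: (is_derive1_comp (is_derive_expR _) e1).
    have e3 : is_derive t 1 (fun s : R => (K * E) * expR (- b * s)) (K * E * (expR (- b * t) * (- b * 1))).
      exact: (is_deriveZ (K * E) e2).
    rewrite (_ : (fun s => B (s, v)) = fun s : R => (K * E) * expR (- b * s)); last first.
      by apply/funext => s; rewrite /B /barrier/= -/E; ring.
    by apply: (is_derive_eq e3); rewrite /B /barrier/= -/E; ring.
  have d3 : is_derive t 1 (fun s => h (s, v)) ('D_1 (F^~ v) t - (- b * B (t, v))).
    exact: is_deriveB d1 d2.
  rewrite -subr_le0; apply: (left_min_derive_le0 t0 d3) => s st.
  exact: hglob.
have c0 : 0 < C * Num.sqrt (japanese_sq v).
  by rewrite mulr_gt0// sqrtr_gt0 japanese_sq_gt0.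
exact: (min_contradiction c0 FtB Bgt0 lap dt (Fsuper t v t0) (Bsub t v t0 FtB)).
Qed.

(** * Partial derivatives of the solution *)

Lemma smooth_derivable (R : realType) (N : nat) (f : R -> 'rV[R]_N -> R) :
  smooth_on [set p : R * 'rV[R]_N | 0 < p.1] (fun p => f p.1 p.2) ->
  [/\ forall t v, 0 < t -> derivable (f^~ v) t 1,
      forall t i v, 0 < t -> derivable (f t) v 'e_i &
      forall t i v, 0 < t -> derivable ('D_('e_i) (f t)) v 'e_i].
Proof.
move=> /(_ 2%N)[_ C2]; pose G p := f p.1 p.2; split => t.
- move=> v t0; have [/(_ (t, v) t0) dG _] := C2 (1, 0).
  (* The line starts at (0, v), so its parameter is the time itself. *)
  have E (s : R) : s *: ((1, 0) : R * 'rV[R]_N) + (0, v) = (s, v).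
    apply: injective_projections => /=; first by rewrite addr0 [LHS]mulr1.
    by rewrite scaler0 add0r.
  have [] := @is_derive_line _ _ G (0, v) (1, 0) t; first by rewrite E.
  by under eq_fun do rewrite E.
- move=> i v t0; have [/(_ (t, v) t0) dG _] := C2 (0, 'e_i).
  exact: (derivable_pair dG).
- move=> i v t0; have [_ [_ /(_ (0, 'e_i))[/(_ (t, v) t0) dG _]]] := C2 (0, 'e_i).
  have -> : 'D_'e_i (f t) = fun x => 'D_((0, 'e_i) : R * 'rV[R]_N) G (t, x).
    by apply/funext => x; exact: (derive_pair G).
  exact: (derivable_pair dG).
Qed.

(** * Comparing |v|^(3/2), <v>^(3/2) and <v - v0>^(3/2) *)

Lemma enorm_powR_le (R : realType) (N : nat) (v : 'rV[R]_N) :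
  enorm v `^ (3 / 2) <= japanese_sq v `^ (3 / 4).
Proof.
have d0 := dot_ge0 v.
rewrite /enorm -powR12_sqrt// -powRrM (_ : 2^-1 * (3 / 2) = 3 / 4 :> R); last lra.
by rewrite ge0_ler_powR ?nnegrE// ?addr_ge0// ?lerDr//; lra.
Qed.

(** For |v| <= 1 the left side is at most 2^(3/4); otherwise <v>^2 <= 2 |v|^2. *)
Lemma japanese_powR_le (R : realType) (N : nat) (v : 'rV[R]_N) :
  japanese_sq v `^ (3 / 4) <= 2 * (1 + enorm v `^ (3 / 2)).
Proof.
have d0 := dot_ge0 v.
have c34 : 2 `^ (3 / 4) <= 2 :> R by rewrite ler1_powR//; lra.
rewrite /enorm -powR12_sqrt// -powRrM (_ : 2^-1 * (3 / 2) = 3 / 4 :> R); last lra.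
have p0 := powR_ge0 (dot v v) (3 / 4).
have [d1|d1] := leP (dot v v) 1.
  apply: (@le_trans _ _ (2 `^ (3 / 4))); last lra.
  by rewrite ge0_ler_powR ?nnegrE ?addr_ge0// /japanese_sq; lra.
apply: (@le_trans _ _ ((2 * dot v v) `^ (3 / 4))).
  by rewrite ge0_ler_powR ?nnegrE ?addr_ge0 ?mulr_ge0// /japanese_sq; lra.
rewrite powRM//.
have : 0 <= (2 - 2 `^ (3 / 4)) * (dot v v) `^ (3 / 4) by rewrite mulr_ge0// subr_ge0.
lra.
Qed.

(** Peetre's inequality raised to the power c; the factor 2 <w>^2 is at least 1, so its power c <= 1
    does not exceed it. *)
Lemma japanese_powRD (R : realType) (N : nat) (c : R) (v w : 'rV[R]_N) :
  0 <= c <= 1 ->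
  japanese_sq (v + w) `^ c <= 2 * japanese_sq w * japanese_sq v `^ c.
Proof.
move=> /andP[c0 c1]; have J0 u : 0 <= japanese_sq u := ltW (@japanese_sq_gt0 R N u).
have w1 := japanese_sq_ge1 w.
have w0 : 0 <= 2 * japanese_sq w by rewrite mulr_ge0.
apply: (@le_trans _ _ ((2 * japanese_sq w * japanese_sq v) `^ c)).
  apply: ge0_ler_powR => //; rewrite ?nnegrE//; first exact: mulr_ge0.
  by rewrite mulrAC; exact: japanese_sqD.
rewrite powRM//; apply: ler_wpM2r; first exact: powR_ge0.
by rewrite ler1_powR//; lra.
Qed.

(** <v - v0>^(3/2) <= 2 q <v>^(3/2) <= 4 q (1 + |v|^(3/2)) with q = <v0>^2; the summand 1 goes into
    the prefactor. *)
Lemma barrier_lower (R : realType) (N : nat) (A a : R) (v0 v : 'rV[R]_N) :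
  0 <= A -> 0 <= a ->
  A * expR (- (4 * a * japanese_sq v0)) *
    expR (- (4 * a * japanese_sq v0) * enorm v `^ (3 / 2)) <= barrier A a v0 v.
Proof.
move=> A0 a0; rewrite -mulrA -expRD /barrier ler_wpM2l// ler_expR.
have : japanese_sq (v - v0) `^ (3 / 4) <= 2 * japanese_sq v0 * japanese_sq v `^ (3 / 4).
  by rewrite -(japanese_sqN v0) japanese_powRD//; lra.
have := japanese_powR_le v; have := japanese_sq_gt0 v0.
move: (japanese_sq (v - v0) `^ _) (japanese_sq v `^ _) (enorm v `^ _) (japanese_sq v0).
move=> x y z q q0 yz xq.
have xz : x <= 4 * q * (1 + z).
  have : 0 <= (2 * (1 + z) - y) * q by rewrite mulr_ge0 ?subr_ge0// ltW.
  lra.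
have : 0 <= a * (4 * q * (1 + z) - x) by rewrite mulr_ge0// subr_ge0.
lra.
Qed.

(** Conversely |v|^(3/2) <= <v>^(3/2) <= 2 <v0>^2 <v - v0>^(3/2), whence the condition on [a]. *)
Lemma barrier_initial (R : realType) (N : nat) (c0 a0 K a : R)
    (v0 v : 'rV[R]_N) :
  0 <= K <= c0 -> 0 <= a0 -> 2 * japanese_sq v0 * a0 <= a ->
  barrier K a v0 v <= c0 * expR (- a0 * enorm v `^ (3 / 2)).
Proof.
move=> /andP[K0 Kc0] a00 aa0.
apply: ler_pM => //.
rewrite ler_expR.
have : japanese_sq (v - v0 + v0) `^ (3 / 4) <=
    2 * japanese_sq v0 * japanese_sq (v - v0) `^ (3 / 4).
  by rewrite japanese_powRD//; lra.
rewrite subrK; have := enorm_powR_le v; have := powR_ge0 (japanese_sq (v - v0)) (3 / 4).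
move: (japanese_sq (v - v0) `^ _) (enorm v `^ _) (japanese_sq v `^ _).
move=> x y z x0 yz zx.
have : 0 <= a0 * (2 * japanese_sq v0 * x - y).
  by rewrite mulr_ge0// subr_ge0 (le_trans yz).
have : 0 <= (a - 2 * japanese_sq v0 * a0) * x by rewrite mulr_ge0// subr_ge0.
lra.
Qed.

(** * The solution as a supersolution, and the choice of constants *)

Lemma solution_supersolution (R : realType) (N : nat) (alpha cN : R)
    (f0 : 'rV[R]_N -> R) (f : R -> 'rV[R]_N -> R) :
  0 < alpha -> 0 < cN -> Linfty_L12 f -> smooth_solution alpha cN f0 f ->
  exists2 C : R, 0 < C & forall t v, 0 < t ->
    - (C * Num.sqrt (japanese_sq v)) * f t v <=
      'D_1 (f^~ v) t - laplacian (f t) v.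
Proof.
move=> alpha0 cN0 fLinfty [f_ge0 fsmooth _ _ feq].
have [df1 _ _] := smooth_derivable fsmooth.
have fc t v : 0 < t -> {for t, continuous (f^~ v)}.
  by move=> t0; apply/differentiable_continuous/derivable1_diffP; exact: df1.
have [M fM] := Linfty_L12_pointwise fLinfty f_ge0 fc.
(* The absolute value and the added 1 make the constant positive whatever the sign of [M]. *)
exists (2 * `|M| + 1) => [|t v t0]; first by rewrite ltr_wpDl// mulr_ge0.
have [mf ftM] := fM t t0.
have ft0 w : 0 <= f t w by rewrite f_ge0// ltW.
apply: le_trans (Q_lower_bound alpha0 cN0 ft0 mf ftM (feq t v t0)).
apply: ler_wpM2r => //; rewrite lerN2; apply: ler_wpM2r; first exact: sqrtr_ge0.
by have := ler_norm M; lra.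
Qed.

(** Read x = <v - v0>, y = <v>, D = |v - v0|^2 / x. As a, x >= 1, the left side is at most a x (2 C
    q + (3/2) n) <= a^2 kappa x <= a^2 D. *)
Lemma barrier_rate (R : realType) (C a q kappa n x y D : R) :
  0 <= C -> 1 <= a -> 0 <= q -> 0 <= kappa -> 0 <= n -> 1 <= x ->
  y <= 2 * q * x -> kappa * x <= D -> 2 * C * q + 3 / 2 * n <= a * kappa ->
  C * y + 3 / 2 * a * n <= 9 / 4 * a ^+ 2 * D.
Proof.
move=> C0 a1 q0 kappa0 n0 x1 yx kxD ak.
have a0 : 0 <= a by lra.
have x0 : 0 <= x by lra.
have h1 : 0 <= C * (2 * q * x - y) by rewrite mulr_ge0 ?subr_ge0.
have h2 : 0 <= a ^+ 2 * (D - kappa * x) by rewrite mulr_ge0 ?subr_ge0 ?exprn_ge0.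
have h3 : 0 <= a * x * (a * kappa - (2 * C * q + 3 / 2 * n)).
  by rewrite !mulr_ge0 ?subr_ge0.
have h4 : 0 <= a ^+ 2 * (kappa * x) by rewrite !mulr_ge0 ?exprn_ge0.
have h5 : 0 <= (a - 1) * x * (C * q) by rewrite !mulr_ge0 ?subr_ge0.
have h6 : 0 <= a * (x - 1) * n by rewrite !mulr_ge0 ?subr_ge0.
lra.
Qed.

Theorem lemma7p3 (R : realType) (N : nat) (hN : (2 <= N)%N)
    (alpha : R) (halpha : 0 < alpha < 1)
    (cN : R) (hcN : kernel_normalized N cN)
    (f0 : 'rV[R]_N -> R) (f : R -> 'rV[R]_N -> R)
    (hLinfty : Linfty_L12 f)
    (hsol : smooth_solution alpha cN f0 f)
    (c0 a0 : R) (hc0 : 0 < c0) (ha0 : 0 < a0)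
    (hf0 : forall v, c0 * expR (- a0 * enorm v `^ (3 / 2)) <= f0 v) :
  (exists K b a : R, [/\ 0 < K, 0 < b, 0 < a &
     forall (t : R) (v : 'rV[R]_N), 0 < t ->
       K * expR (- b * t - a * enorm v `^ (3 / 2)) <= f t v]) /\
  (forall (c1 : R) (v0 : 'rV[R]_N) (r0 : R), 0 < c1 -> 0 < r0 ->
     (forall (t : R) (v : 'rV[R]_N), 0 < t -> enorm (v - v0) < r0 ->
        c1 <= f t v) ->
     exists K a : R, [/\ 0 < K, 0 < a &
       forall (t : R) (v : 'rV[R]_N), 0 < t ->
         K * expR (- a * enorm v `^ (3 / 2)) <= f t v]).
Proof.
have alpha0 : 0 < alpha by case/andP: halpha.
have [cN0 _] := hcN.
have [C C0 fsuper] := solution_supersolution alpha0 cN0 hLinfty hsol.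
have [f_ge0 fsmooth fcont finit _] := hsol.
have [df1 df ddf] := smooth_derivable fsmooth.
have J1 := @japanese_sq_ge1 R N.
have JE (v : 'rV[R]_N) : dot v v = japanese_sq v - 1 by rewrite /japanese_sq; ring.
have sq1 (v : 'rV[R]_N) : 1 <= Num.sqrt (japanese_sq v).
  by rewrite -[leLHS]sqrtr1 ler_wsqrtr.
have sqV (v : 'rV[R]_N) : (Num.sqrt (japanese_sq v))^-1 <= 1.
  by rewrite invf_le1// (lt_le_trans ltr01).
have dotV (v : 'rV[R]_N) : dot v v / Num.sqrt (japanese_sq v) =
    Num.sqrt (japanese_sq v) - (Num.sqrt (japanese_sq v))^-1.
  rewrite JE mulrBl mul1r; congr (_ - _).
  rewrite -[X in X / _]sqr_sqrtr ?(le_trans ler01)// expr2 mulfK//.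
  by rewrite gt_eqF// (lt_le_trans ltr01).
split.
  (* Barrier centred at 0: [2 * a0] serves the initial comparison, and a >= C, a >= 1 give C <=
     (9/4) a^2. *)
  pose a := 2 * a0 + C + 1.
  have a1 : 1 <= a by rewrite /a; lra.
  have aC : C <= 9 / 4 * a ^+ 2.
    have : 0 <= a * (a - 1) by rewrite mulr_ge0; lra.
    by have : C <= a by [rewrite /a; lra]; rewrite expr2; lra.
  (* By [dotV] the gain is (9/4) a^2 (<v> - 1/<v>); [b] pays for the part with 1/<v> <= 1 and for
     the term (3/2) a N. *)
  pose b := 3 / 2 * a * N%:R + 9 / 4 * a ^+ 2.
  have b0 : 0 < b.
    by rewrite ltr_wpDl ?mulr_ge0 ?mulr_gt0 ?exprn_gt0//; lra.
  have q01 : japanese_sq (0 : 'rV[R]_N) = 1.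
    by rewrite /japanese_sq /dot big1 ?addr0// => i _; rewrite mxE mul0r.
  exists (c0 * expR (- (4 * a))), b, (4 * a); split => //.
  - by rewrite mulr_gt0// expR_gt0.
  - by lra.
  move=> t v t0.
  have a_gt0 : 0 < a by lra.
  have := barrier_comparison C0 hc0 (ltW b0) a_gt0 f_ge0 fcont df1 df ddf fsuper (v0 := 0).
  move=> /(_ _ _ t v t0) h; apply: le_trans (h _ _).
  + apply: le_trans (barrier_lower _ _ _ _); last 2 first.
    * by rewrite mulr_ge0 ?expR_ge0// ltW.
    * exact: ltW.
    rewrite q01 mulr1 expRD -!mulNr; lra.
  + move=> w; rewrite finit; apply: le_trans (hf0 w).
    by apply: barrier_initial; rewrite ?q01; rewrite /a; lra.
  + move=> s w s0 _; rewrite subr0 dotV.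
    have := sq1 w; have := sqV w; move: (Num.sqrt _) => x xV x1.
    have : 0 <= (9 / 4 * a ^+ 2 - C) * x by rewrite mulr_ge0//; lra.
    have : 0 <= 9 / 4 * a ^+ 2 * (1 - x^-1) by rewrite mulr_ge0 ?subr_ge0//; lra.
    by rewrite /b; lra.
move=> c1 v0 r0 c10 r00 fball.
pose q0 := japanese_sq v0.
have q01 : 1 <= q0 := J1 v0.
(* The minimum of |z|^2 / <z>^2 over |z| >= r0. *)
pose kappa := r0 ^+ 2 / (1 + r0 ^+ 2).
have r2 : 0 < r0 ^+ 2 by rewrite exprn_gt0.
have kappa0 : 0 < kappa by rewrite divr_gt0//; lra.
pose c := 2 * C * q0 + 3 / 2 * N%:R.
have N0 : 0 <= N%:R :> R by [].
have Cq0 : 0 < C * q0 by rewrite mulr_gt0//; lra.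
have c_ge0 : 0 <= c by rewrite /c; lra.
(* The summands serve, in order, the initial comparison, the condition c <= a kappa of
   [barrier_rate], and a >= 1. *)
pose a := 2 * q0 * a0 + c / kappa + 1.
have q0a0 : 0 < q0 * a0 by rewrite mulr_gt0//; lra.
have ck0 : 0 <= c / kappa by rewrite divr_ge0// ltW.
have a1 : 1 <= a by rewrite /a; lra.
have ak : c <= a * kappa.
  by rewrite -ler_pdivrMr// /a; lra.
(* [c0] serves the initial comparison; with K <= c1 and rate 0 the barrier never exceeds [c1]. *)
pose K := Num.min c0 c1.
have K0 : 0 < K by rewrite lt_min hc0.
have a_gt0 : 0 < a by lra.
exists (K * expR (- (4 * a * q0))), (4 * a * q0); split.
- by rewrite mulr_gt0 ?expR_gt0.
- by rewrite !mulr_gt0//; lra.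
move=> t v t0.
have := barrier_comparison C0 K0 (lexx 0) a_gt0 f_ge0 fcont df1 df ddf fsuper (v0 := v0).
move=> /(_ _ _ t v t0) h; apply: le_trans (h _ _).
- by rewrite oppr0 mul0r expR0 mulr1; apply: barrier_lower; exact: ltW.
- move=> w; rewrite finit; apply: le_trans (hf0 w).
  apply: barrier_initial; first by rewrite (ltW K0) ge_min lexx.
    exact: ltW.
  by rewrite /a -/q0; lra.
move=> s w s0; rewrite oppr0 mul0r expR0 mulr1 add0r => fB.
(* Inside the ball f >= c1 >= K >= barrier, so f can lie below the barrier only outside it. *)
have r0w : r0 <= enorm (w - v0).
  rewrite leNgt; apply/negP => /(fball s w s0); apply/negP; rewrite -ltNge.
  apply: lt_le_trans fB _; apply: (@le_trans _ _ K); last by rewrite ge_min lexx orbT.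
  rewrite /barrier ler_piMr ?(ltW K0)// -[leRHS]expR0 ler_expR oppr_le0.
  by rewrite mulr_ge0 ?powR_ge0// ltW.
have Dr : r0 ^+ 2 <= dot (w - v0) (w - v0).
  by rewrite -sqr_enorm ler_pXn2r ?nnegrE ?sqrtr_ge0// ltW.
have kD : kappa * Num.sqrt (japanese_sq (w - v0)) <=
    dot (w - v0) (w - v0) / Num.sqrt (japanese_sq (w - v0)).
  rewrite ler_pdivlMr ?(lt_le_trans ltr01)// -mulrA -expr2 sqr_sqrtr ?(le_trans ler01)//.
  rewrite /kappa mulrAC ler_pdivrMr ?addr_gt0//.
  by rewrite /japanese_sq mulrDr mulr1 mulrDr mulr1 [X in _ + X]mulrC lerD2r.
have sw : Num.sqrt (japanese_sq w) <= 2 * q0 * Num.sqrt (japanese_sq (w - v0)).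
  have half : 0 <= (2^-1 : R) <= 1 by rewrite invr_ge0 ler0n invf_le1// ler1n.
  have := japanese_powRD (w - v0) v0 half.
  by rewrite subrK !powR12_sqrt ?(le_trans ler01).
exact: (barrier_rate (ltW C0) a1 (le_trans ler01 q01) (ltW kappa0) N0
  (sq1 (w - v0)) sw kD ak).
Qed.
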